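(* Let $\Omega\subset\mathbb{R}^n$ be a nonempty open bounded convex set of class $C^2$ such that $$M(\Omega)=\overline{\Sigma}(\Omega)=:S .$$ Then $S$ is a singleton and $\Omega$ is a ball.
   Context: For a nonempty closed set $K\subset\mathbb{R}^n$, $d_K(x):=\min_{y\in K}|x-y|$ denotes the Euclidean distance function from $K$, and $\pi_K(x)$ is the set of points $y\in K$ with $|x-y|=d_K(x)$. For an open bounded domain $\Omega\subset\mathbb{R}^n$: - the skeleton $\Sigma(\Omega)$ is the set of points $x\in\Omega$ at which $d_{\partial\Omega}$ is not differentiable (equivalently, such that $\pi_{\partial\Omega}(x)$ is not a singleton); - the cut locus $\overline{\Sigma}(\Omega)$ is the closure of $\Sigma(\Omega)$ in $\overline\Omega$; - the high ridge $M(\Omega)$ is the set where $d_{\partial\Omega}$ attains its maximum over $\overline\Omega$. An open set $\Omega\subset\mathbb{R}^n$ is of class $C^k$ if for every $x_0\in\partial\Omega$ there exist a neighborhood $U$ of $x_0$ and a bijective map $\psi:B_1(0)\to U$ with $\psi\in C^k(B_1(0))$, $\psi^{-1}\in C^k(U)$, $\psi(B_1(0)\cap\{x_n>0\})=\Omega\cap U$, $\psi(B_1(0)\cap\{x_n=0\})=\partial\Omega\cap U$. *)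

(* Defs.v *)
From HB Require Import structures.
From mathcomp Require Import all_boot all_order all_algebra.
From mathcomp Require Import all_classical all_reals all_analysis.

Set Implicit Arguments.
Unset Strict Implicit.
Unset Printing Implicit Defensive.

Import Order.TTheory GRing.Theory Num.Theory.
Import numFieldNormedType.Exports.

Local Open Scope classical_set_scope.
Local Open Scope ring_scope.

(* Row vectors carry the sup norm `|x| and the corresponding balls; it induces
   the same open sets, bounded sets and differentials as the Euclidean norm,
   but metric notions (distance, balls) must go through [enorm]. *)
Definition enorm (R : realType) (n : nat) (x : 'rV[R]_n) : R :=
  Num.sqrt (\sum_(i < n) x 0 i ^+ 2).

Definition eball (R : realType) (n : nat) (c : 'rV[R]_n) (r : R)
    : set 'rV[R]_n :=
  [set x | enorm (x - c) < r].

(* For a nonempty closed K the infimum is attained. *)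
Definition edist (R : realType) (n : nat) (K : set 'rV[R]_n) (x : 'rV[R]_n)
    : R :=
  inf [set enorm (x - y) | y in K].

Definition boundary (T : topologicalType) (A : set T) : set T :=
  closure A `\` A°.

Definition skeleton (R : realType) (n : nat) (Omega : set 'rV[R]_n.+1)
    : set 'rV[R]_n.+1 :=
  [set x | Omega x /\ ~ differentiable (edist (boundary Omega)) x].

(* Closure relative to the subspace [closure Omega]. *)
Definition cut_locus (R : realType) (n : nat) (Omega : set 'rV[R]_n.+1)
    : set 'rV[R]_n.+1 :=
  closure Omega `&` closure (skeleton Omega).

Definition high_ridge (R : realType) (n : nat) (Omega : set 'rV[R]_n.+1)
    : set 'rV[R]_n.+1 :=
  [set x | closure Omega x /\
    forall y, closure Omega y ->
      edist (boundary Omega) y <= edist (boundary Omega) x].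

(* f is of class C^k on the open set A.  In finite dimension, x |-> 'd f x is
   of class C^k iff all its evaluations x |-> 'd f x v are. *)
Fixpoint Ck_on (R : realType) (V W : normedModType R) (k : nat) (A : set V)
    (f : V -> W) : Prop :=
  match k with
  | 0 => forall x, A x -> {for x, continuous f}
  | j.+1 => (forall x, A x -> differentiable f x) /\
            (forall v : V, Ck_on j A (fun x => 'd f x v))
  end.

(* psi and phi are the chart and its inverse; only their restrictions to the
   unit ball and to U matter.  The last coordinate is [ord_max]. *)
Definition Ck_domain (R : realType) (n : nat) (k : nat)
    (Omega : set 'rV[R]_n.+1) : Prop :=
  forall x0, boundary Omega x0 ->
    exists (U : set 'rV[R]_n.+1) (psi phi : 'rV[R]_n.+1 -> 'rV[R]_n.+1),
      let B := eball 0 1 in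
      [/\ open_nbhs x0 U,
          set_bij B U psi /\ {in B, cancel psi phi},
          Ck_on k B psi /\ Ck_on k U phi,
          psi @` (B `&` [set y : 'rV[R]_n.+1 | 0 < y 0 ord_max]) = Omega `&` U &
          psi @` (B `&` [set y : 'rV[R]_n.+1 | y 0 ord_max = 0]) = boundary Omega `&` U].

(* Main.v *)
(** On convex [Omega] the distance [d] to the boundary is concave, so [S] is
    convex, and [d] equals its maximum [r] on [S].  Every [q] in [Omega] has
    distance less than [r] to [S]: maximise [d - (1 - e) |. - q|]; at a point
    where [d] is differentiable it has slope 1, so the maximiser lies in the
    skeleton.  Hence [Omega] is the [r]-neighbourhood of [S].

    If [S] had two points, take [c] in [S] farthest from some [a] in [S], the
    unit vector [e] from [a] to [c], and the outer unit normal [v] at a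
    projection of the midpoint of [a] and [c].  Then [v] is orthogonal to [e],
    and in the plane through [c] spanned by [e] and [v] the boundary near
    [p = c + r v] is a segment on one side of [p] and an arc of radius [r] on
    the other.  The curvature jumps at [p], which contradicts [C^2]
    regularity. *)
Require Import Defs.
From HB Require Import structures.
From mathcomp Require Import all_boot all_order all_algebra.
From mathcomp Require Import all_classical all_reals all_analysis.
From mathcomp Require Import ring lra.
Import Order.TTheory GRing.Theory Num.Theory.
Import numFieldNormedType.Exports.
Local Open Scope classical_set_scope.
Local Open Scope ring_scope.

(* MathComp-Analysis has its own [edist]. *)
Local Notation edist := Defs.edist.

(** * Euclidean inner product and norm, compared with the sup-norm topology *)

Section Euclid.
Context {R : realType} {n : nat}.
Implicit Types x y z v w : 'rV[R]_n.

Definition dot x y : R := \sum_i x 0 i * y 0 i.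

Lemma dotC x y : dot x y = dot y x.
Proof. by apply: eq_bigr => i _; rewrite mulrC. Qed.

Lemma dotDl x y z : dot (x + y) z = dot x z + dot y z.
Proof. by rewrite -big_split; apply: eq_bigr => i _; rewrite mxE mulrDl. Qed.

Lemma dotZl (a : R) x y : dot (a *: x) y = a * dot x y.
Proof. by rewrite mulr_sumr; apply: eq_bigr => i _; rewrite mxE mulrA. Qed.

Lemma dotNl x y : dot (- x) y = - dot x y.
Proof. by rewrite -scaleN1r dotZl mulN1r. Qed.

Lemma dotDr x y z : dot x (y + z) = dot x y + dot x z.
Proof. by rewrite dotC dotDl !(dotC x). Qed.

Lemma dotZr (a : R) x y : dot x (a *: y) = a * dot x y.
Proof. by rewrite dotC dotZl dotC. Qed.

Lemma dotNr x y : dot x (- y) = - dot x y.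
Proof. by rewrite dotC dotNl dotC. Qed.

Definition dotE := (dotDl, dotDr, dotNl, dotNr, dotZl, dotZr).

Lemma dot_ge0 x : 0 <= dot x x.
Proof. by apply: sumr_ge0 => i _; rewrite -expr2 sqr_ge0. Qed.

Lemma enorm_ge0 x : 0 <= enorm x.
Proof. exact: sqrtr_ge0. Qed.

Lemma enormE x : enorm x = Num.sqrt (dot x x).
Proof. by congr Num.sqrt; apply: eq_bigr => i _; rewrite expr2. Qed.

Lemma sqr_enorm x : enorm x ^+ 2 = dot x x.
Proof. by rewrite enormE sqr_sqrtr ?dot_ge0. Qed.

Lemma enorm_le x (a : R) : 0 <= a -> (enorm x <= a) = (dot x x <= a ^+ 2).
Proof. by move=> a0; rewrite -sqr_enorm ler_sqr ?nnegrE ?enorm_ge0. Qed.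

Lemma enorm_lt x (a : R) : 0 <= a -> (enorm x < a) = (dot x x < a ^+ 2).
Proof. by move=> a0; rewrite -sqr_enorm ltr_sqr ?nnegrE ?enorm_ge0. Qed.

Lemma enorm_ge x (a : R) : 0 <= a -> (a <= enorm x) = (a ^+ 2 <= dot x x).
Proof. by move=> a0; rewrite -sqr_enorm ler_sqr ?nnegrE ?enorm_ge0. Qed.

(** Lets Euclidean estimates control the sup-norm neighbourhoods that define the topology. *)
Lemma norm_le_enorm x : `|x| <= enorm x.
Proof.
rewrite [`|x|]mx_normrE; apply: bigmax_le; first exact: enorm_ge0.
move=> [i j] _ /=; rewrite enorm_ge // (ord1 i) real_normK ?num_real //.
rewrite /dot (bigD1 j) //= -expr2 lerDl.
by apply: sumr_ge0 => k _; rewrite -expr2 sqr_ge0.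
Qed.

Lemma enorm_eq0 x : enorm x = 0 -> x = 0.
Proof.
move=> x0; apply/normr0_eq0/eqP.
by rewrite eq_le normr_ge0 andbT -x0 norm_le_enorm.
Qed.

Lemma enorm0 : enorm (0 : 'rV[R]_n) = 0.
Proof. by rewrite enormE -(scale0r 0) dotZl mul0r sqrtr0. Qed.

Lemma enormZ (a : R) x : enorm (a *: x) = `|a| * enorm x.
Proof.
by rewrite !enormE !dotE mulrA -expr2 sqrtrM ?sqr_ge0 // sqrtr_sqr.
Qed.

Lemma enormN x : enorm (- x) = enorm x.
Proof. by rewrite -scaleN1r enormZ normrN normr1 mul1r. Qed.

Lemma enormB x y : enorm (x - y) = enorm (y - x).
Proof. by rewrite -enormN opprB. Qed.

(** Cauchy-Schwarz: with a = |x| and b = |y|, expanding the square of |b x - a y| gives 2ab(ab -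
    [dot x y]), which is nonnegative. *)
Lemma dot_le_enorm x y : dot x y <= enorm x * enorm y.
Proof.
have [x0|x0] := eqVneq (enorm x) 0.
  by rewrite (enorm_eq0 _ x0) enorm0 mul0r -(scale0r 0) dotZl mul0r.
have [y0|y0] := eqVneq (enorm y) 0.
  by rewrite (enorm_eq0 _ y0) enorm0 mulr0 -(scale0r 0) dotZr mul0r.
have := dot_ge0 (enorm y *: x - enorm x *: y).
rewrite !dotE (dotC y x) -!sqr_enorm.
have xp : 0 < enorm x by rewrite lt0r x0 enorm_ge0.
have yp : 0 < enorm y by rewrite lt0r y0 enorm_ge0.
set a := enorm x in xp *; set b := enorm y in yp *; set d := dot x y => h.
have : 0 <= (a * b) * (a * b - d) by nra.
by rewrite pmulr_rge0 ?mulr_gt0 // subr_ge0.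
Qed.

Lemma enormD x y : enorm (x + y) <= enorm x + enorm y.
Proof.
rewrite enorm_le ?addr_ge0 ?enorm_ge0 // !dotE (dotC y x).
have := dot_le_enorm x y; rewrite -!sqr_enorm; nra.
Qed.

Lemma enorm_triangle y x z : enorm (x - z) <= enorm (x - y) + enorm (y - z).
Proof. by rewrite -[x - z](subrKA y) enormD. Qed.

Lemma enorm_continuous : continuous (@enorm R n).
Proof.
have c : continuous (fun x : 'rV[R]_n => \sum_(i < n) x 0 i ^+ 2).
  apply: continuous_big => [|i _ x /=]; first exact: add_continuous.
  apply: (@continuous_comp _ _ _ (fun x : 'rV[R]_n => x 0 i) (fun t => t ^+ 2)).
    exact: coord_continuous.
  exact: exprn_continuous.
move=> x; apply: (continuous_comp (c x)); exact: sqrt_continuous.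
Qed.

Lemma closure_enorm (A : set 'rV[R]_n) x :
  (forall e : R, 0 < e -> exists2 y, A y & enorm (y - x) < e) -> closure A x.
Proof.
move=> h B /nbhs_normP[e /= e0 eB].
have [y Ay yx] := h e e0; exists y; split => //; apply: eB => /=.
by apply: le_lt_trans yx; rewrite enormB norm_le_enorm.
Qed.

Lemma near_enorm x (e : R) : 0 < e -> \forall y \near x, enorm (y - x) < e.
Proof.
move=> e0.
have c : {for x, continuous (fun y : 'rV[R]_n => enorm (y - x))}.
  apply: (@continuous_comp _ _ _ (fun y : 'rV[R]_n => y - x)).
    by apply: continuousB; [move=> ?; exact: cvg_id|exact: cst_continuous].
  exact: enorm_continuous.
by apply: (cvgr_lt (enorm (x - x)) c); rewrite subrr enorm0.
Qed.

Lemma enorm_closure (A : set 'rV[R]_n) x (e : R) :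
  closure A x -> 0 < e -> exists2 y, A y & enorm (y - x) < e.
Proof. by move=> Ax e0; have [y []] := Ax _ (near_enorm x e e0); exists y. Qed.
End Euclid.

(** * Distance to a set, and segments that cross a boundary *)

Lemma continuous_line {R : realType} {V : normedModType R} (x v : V) :
  continuous (fun t : R => x + t *: v).
Proof.
move=> t; apply: (@continuousD R V R (fun=> x) (fun t => t *: v)).
  exact: cst_continuous.
exact: scalel_continuous.
Qed.

Section Distance.
Context {R : realType} {n : nat}.
Implicit Types (K A : set 'rV[R]_n) (x y : 'rV[R]_n).

Lemma edist_le K x y : K y -> edist K x <= enorm (x - y).
Proof.
move=> Ky; apply: ge_inf; last by exists y.
by exists 0 => _ [z _ <-]; exact: enorm_ge0.
Qed.

Lemma edist_ge K x (a : R) : K !=set0 ->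
  (forall y, K y -> a <= enorm (x - y)) -> a <= edist K x.
Proof.
move=> [y Ky] h; apply: lb_le_inf; first by exists (enorm (x - y)), y.
by move=> _ [z Kz <-]; exact: h.
Qed.

Lemma edist_lip K x y : K !=set0 -> edist K x <= edist K y + enorm (x - y).
Proof.
move=> K0; rewrite -lerBlDr; apply: edist_ge => // z Kz.
rewrite lerBlDr addrC; apply: le_trans (enorm_triangle y _ _).
exact: edist_le.
Qed.

Lemma edist_continuous K : K !=set0 -> continuous (edist K).
Proof.
move=> K0 x; apply/(@cvgrPdist_le _ _ _ (nbhs x)) => e e0.
near=> y; have yx : enorm (y - x) < e by near: y; exact: near_enorm.
rewrite ler_distl.
have := edist_lip K x y K0; have := edist_lip K y x K0.
rewrite (enormB x y) => ? ?; apply/andP; split; lra.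
Unshelve. all: by end_near. Qed.

Lemma edist_attained K x : K !=set0 -> compact K ->
  exists2 y, K y & edist K x = enorm (x - y).
Proof.
move=> K0 cK.
have [] := @EVT_min_rV R n (fun y => enorm (x - y)) K K0 cK.
  apply: continuous_subspaceT => y.
  apply: (@continuous_comp _ _ _ (fun y : 'rV[R]_n => x - y)).
    by apply: continuousB; [exact: cst_continuous|move=> ?; exact: cvg_id].
  exact: enorm_continuous.
move=> y; rewrite inE => Ky h; exists y => //.
apply/le_anti; rewrite edist_le //=; apply: edist_ge => // z Kz.
by apply: h; rewrite inE.
Qed.

Lemma bounded_closure A : bounded_set A -> bounded_set (closure A).
Proof.
move=> [M0 [M0r AM0]]; exists M0; split=> // M /AM0 AM x Ax.
have c : closed [set y : 'rV[R]_n | `|y| <= M].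
  apply: (@closed_comp _ _ (fun y : 'rV[R]_n => `|y|) [set t | t <= M]).
    by move=> y _; exact: norm_continuous.
  exact: closed_le.
by apply: c; apply: closureS Ax => y; exact: AM.
Qed.

Lemma compact_closure_bounded A : bounded_set A -> compact (closure A).
Proof.
move=> bA; apply: bounded_closed_compact; last exact: closed_closure.
exact: bounded_closure.
Qed.

Lemma compact_boundary A : bounded_set A -> compact (boundary A).
Proof.
move=> bA; apply: (subclosed_compact _ (compact_closure_bounded A bA)).
  apply: closedI; first exact: closed_closure.
  by rewrite closedC; exact: open_interior.
by move=> x [].
Qed.

(* A segment from inside to outside of [A] is connected, so it meets the boundary. *)
Lemma boundary_segment A x y : open A -> A x -> ~ A y ->
  exists2 z, boundary A z & enorm (x - z) <= enorm (x - y).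
Proof.
move=> oA Ax Ay.
pose g (t : R) := x + t *: (y - x).
have gc : continuous g by exact: continuous_line.
apply: contrapT => h.
have hb (t : R) : 0 <= t <= 1 -> closure A (g t) -> A (g t).
  move=> /andP[t0 t1] At; apply: contrapT => nAt; apply: h; exists (g t).
    by split => // /interior_subset.
  rewrite /g opprD addNKr enormN enormZ ger0_norm // enormB.
  by rewrite ler_piMl // enorm_ge0.
have := @segment_connected R 0 1 (`[0, 1] `&` g @^-1` A).
move=> /(_ _ _ _)/seteqP[].
- exists 0; split; first by rewrite /= in_itv /= lexx ler01.
  by rewrite /= /g scale0r addr0.
- by exists (g @^-1` A) => //; apply: open_comp => // t _; exact: gc.
- exists (g @^-1` closure A).
    by apply: closed_comp => [t _|]; [exact: gc|exact: closed_closure].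
  apply/seteqP; split => t [/= t01 At]; split => //.
    exact: subset_closure.
  by apply: hb => //; move: t01; rewrite in_itv.
- move=> _ /(_ 1)[].
    by rewrite /= in_itv /= ler01 lexx.
  by move=> _; rewrite /= /g scale1r subrKC.
Qed.
End Distance.

Lemma dnbhs0P {R : realType} (P : set R) : (\forall h \near 0^', P h) ->
  exists2 e : R, 0 < e & forall h, h != 0 -> `|h| < e -> P h.
Proof.
move=> /nbhs_normP[e /= e0 eP]; exists e => // h h0 he.
by apply: eP => //=; rewrite sub0r normrN.
Qed.

(** * Distance to the boundary of a bounded open set *)

Section Domain.
Context {R : realType} {n : nat} (Omega : set 'rV[R]_n.+1).
Hypothesis Omega_neq0 : Omega !=set0.
Hypothesis Omega_open : open Omega.
Hypothesis Omega_bounded : bounded_set Omega.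
Implicit Types x y z w : 'rV[R]_n.+1.

Let d := edist (boundary Omega).

Lemma boundaryN x : boundary Omega x -> ~ Omega x.
Proof. by case=> _ nx Ox; apply: nx; exact: open_nbhs_nbhs. Qed.

Lemma boundary_neq0 : boundary Omega !=set0.
Proof.
have [x Ox] := Omega_neq0; have [M0 [M0r AM]] := Omega_bounded.
pose v : 'rV[R]_n.+1 := const_mx 1.
have v0 : 0 < `|v|.
  rewrite normr_gt0; apply/eqP => /matrixP/(_ 0 0).
  by rewrite !mxE; apply/eqP/oner_neq0.
pose M := `|M0| + 1.
have M_gt0 : 0 < M by rewrite ltr_wpDl.
have AM' y : Omega y -> `|y| <= M.
  by apply: (AM M); rewrite (le_lt_trans (ler_norm _)) // ltrDl.
(* The end point has norm [M + 1], so it lies outside [Omega], and the segment from [x] to it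
   crosses the boundary. *)
have [|z bz _] :=
  boundary_segment _ x (((M + 1) / `|v|) *: v) Omega_open Ox.
  move=> /AM'; rewrite normrZ normrM normfV normr_id divfK ?gt_eqF //.
  by rewrite ger0_norm ?addr_ge0 ?(ltW M_gt0) // gerDl; rewrite ler10.
by exists z.
Qed.

Lemma dist_attained x : exists2 y, boundary Omega y & d x = enorm (x - y).
Proof.
apply: edist_attained; first exact: boundary_neq0.
exact: compact_boundary.
Qed.

Lemma dist_ge0 x : 0 <= d x.
Proof. by have [y _ ->] := dist_attained x; exact: enorm_ge0. Qed.

Lemma dist_gt0 x : Omega x -> 0 < d x.
Proof.
move=> Ox; rewrite lt0r dist_ge0 andbT; apply/eqP.
have [y /boundaryN Oy ->] := dist_attained x.
by move=> /enorm_eq0/subr0_eq xy; apply: Oy; rewrite -xy.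
Qed.

Lemma dist_gt0_in x : closure Omega x -> 0 < d x -> Omega x.
Proof.
move=> cx dx; apply: contrapT => nx.
have bx : boundary Omega x by split => // /interior_subset.
by have := edist_le _ x _ bx; rewrite subrr enorm0 leNgt dx.
Qed.

Lemma dist_ball x y : Omega x -> enorm (x - y) < d x -> Omega y.
Proof.
move=> Ox xy; apply: contrapT => Oy.
have [z bz] := boundary_segment _ _ _ Omega_open Ox Oy.
by move/(le_lt_trans)/(_ xy); rewrite ltNge edist_le.
Qed.

Lemma dist_cball x y : Omega x -> enorm (y - x) <= d x -> closure Omega y.
Proof.
move=> Ox xy; apply: closure_enorm => e e0.
have d0 := dist_gt0 _ Ox.
(* Moving [y] towards the centre [x] by the fraction [t] brings it into the open ball of radius
   [d x], at a cost below [e]. *)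
have [t /andP[t0 t1] te] : exists2 t : R, 0 < t <= 1 & t * d x < e.
  have E : e / (2 * d x) * d x = e / 2 by field; rewrite gt_eqF.
  exists (Num.min 1 (e / (2 * d x))).
    by rewrite lt_min ltr01 divr_gt0 ?mulr_gt0 //= ge_min lexx.
  have : Num.min 1 (e / (2 * d x)) <= e / (2 * d x) by rewrite ge_min lexx orbT.
  by move/(ler_wpM2r (ltW d0))/le_lt_trans; apply; rewrite E; lra.
exists (y + t *: (x - y)).
  apply: dist_ball Ox _.
  have -> : x - (y + t *: (x - y)) = (1 - t) *: (x - y).
    by rewrite scalerBl scale1r opprD addrA.
  rewrite enormZ ger0_norm ?subr_ge0 // enormB.
  apply: (@le_lt_trans _ _ ((1 - t) * d x)).
    by rewrite ler_wpM2l // subr_ge0.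
  by nra.
rewrite addrC addKr enormZ ger0_norm ?(ltW t0) // enormB.
by apply: le_lt_trans te; rewrite ler_wpM2l // ltW.
Qed.

(** Let [m] point from a nearest boundary point [y] to [x]. Walking from [x] towards [y] decreases
    [d] at rate at least 1. Differentiability makes the derivative along [m] two-sided, so walking
    away from [y] increases [d] at nearly that rate. *)
Lemma dist_slope x (e : R) : Omega x -> differentiable d x -> 0 < e ->
  exists z, [/\ Omega z, 0 < enorm (z - x)
    & d x + (1 - e) * enorm (z - x) <= d z].
Proof.
move=> Ox dx e0; have [y by_ dy] := dist_attained x.
have d0 := dist_gt0 _ Ox.
pose m := (d x)^-1 *: (x - y).
have m1 : enorm m = 1 by rewrite enormZ gtr0_norm ?invr_gt0 // -dy mulVf ?gt_eqF.
have mE : d x *: m = x - y by rewrite scalerA mulfV ?gt_eqF // scale1r.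
pose q (h : R) : R := h^-1 * (d (h *: m + x) - d x).
have qc : q h @[h --> 0^'] --> 'D_m d x by exact: (diff_derivable dx).
(* Only difference quotients at negative steps are estimated, through
   [d (x - h m) <= |x - h m - y| = d x - h]. *)
have ql : 1 <= 'D_m d x.
  rewrite leNgt; apply/negP => /(cvgr_lt _ qc)/dnbhs0P[k k0 kq].
  pose h := Num.min k (d x) / 2.
  have h0 : 0 < h by rewrite divr_gt0 // lt_min k0.
  have hk : h < k.
    by have : Num.min k (d x) <= k; [rewrite ge_min lexx|rewrite /h; lra].
  have hd : h < d x.
    by have : Num.min k (d x) <= d x; [rewrite ge_min lexx orbT|rewrite /h; lra].
  have := kq (- h); rewrite oppr_eq0 gt_eqF // normrN gtr0_norm // => /(_ isT hk).
  rewrite /q; have : d (- h *: m + x) <= d x - h.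
    apply: le_trans (edist_le _ _ _ by_) _.
    have -> : - h *: m + x - y = (d x - h) *: m.
      by rewrite scalerBl mE scaleNr -addrA addrC.
    by rewrite enormZ m1 mulr1 gtr0_norm // subr_gt0.
  rewrite invrN mulNr -mulrN mulrC ltr_pdivrMr // => ? ?.
  lra.
have : \forall h \near 0^', 1 - e < q h.
  by apply: (cvgr_gt _ qc); rewrite ltrBlDr (le_lt_trans ql) // ltrDl.
move=> /dnbhs0P[k k0 kq].
pose h := Num.min k (d x) / 2.
have h0 : 0 < h by rewrite divr_gt0 // lt_min k0.
have hk : h < k.
  by have : Num.min k (d x) <= k; [rewrite ge_min lexx|rewrite /h; lra].
have hd : h < d x.
  by have : Num.min k (d x) <= d x; [rewrite ge_min lexx orbT|rewrite /h; lra].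
have E : enorm (h *: m + x - x) = h by rewrite addrK enormZ m1 mulr1 gtr0_norm.
exists (h *: m + x); rewrite E; split => //.
  by apply: dist_ball Ox _; rewrite enormB E.
have := kq h; rewrite gt_eqF // gtr0_norm // => /(_ isT hk).
by rewrite /q mulrC ltr_pdivlMr // => ?; lra.
Qed.

Lemma skeleton_near (r : R) q : Omega q ->
  (forall y, Omega y -> d y <= r) ->
  exists2 z, skeleton Omega z & enorm (z - q) < r.
Proof.
move=> Oq dr; have d0 := dist_gt0 _ Oq; have dq := dr _ Oq.
have r0 : 0 < r by exact: lt_le_trans dq.
(* Since [e * r] is half of [d q], comparing a maximiser [z] of [g] with [q] gives (1 - e)|z - q| <=
   r - d q < (1 - e) r. *)
pose e := d q / (2 * r).
have er : e * r = d q / 2 by rewrite /e invfM mulrA mulfVK ?gt_eqF.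
have e0 : 0 < e by rewrite divr_gt0 // mulr_gt0.
have e1 : e < 1 by rewrite ltr_pdivrMr; lra.
pose g y := d y - (1 - e) * enorm (y - q).
have gc : continuous g.
  move=> y; apply: continuousB.
    by apply: edist_continuous; exact: boundary_neq0.
  apply: (@continuousM _ _ (fun=> 1 - e)); first exact: cst_continuous.
  apply: (@continuous_comp _ _ _ (fun y => y - q)).
    by apply: continuousB; [move=> ?; exact: cvg_id|exact: cst_continuous].
  exact: enorm_continuous.
have [|z] := @EVT_max_rV R n.+1 g (closure Omega) _
  (compact_closure_bounded _ Omega_bounded) (continuous_subspaceT gc).
  by exists q; exact: subset_closure.
rewrite inE => cz zmax.
have gmax y : Omega y -> g y <= g z.
  by move=> Oy; apply: zmax; rewrite inE; exact: subset_closure.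
have zq0 := enorm_ge0 (z - q).
have := gmax _ Oq; rewrite /g subrr enorm0 mulr0 subr0 => gz.
have Oz : Omega z by apply: dist_gt0_in => //; nra.
exists z; last by have := dr _ Oz; nra.
split => // dz.
(* The slope 1 - e/2 beats the penalty rate 1 - e, so [g w] would exceed the maximum [g z]. *)
have [|w [Ow wz dw]] := @dist_slope z (e / 2) Oz dz; first by rewrite divr_gt0.
have := gmax _ Ow; rewrite /g.
have := enorm_triangle z w q; nra.
Qed.
End Domain.

(** * Second-order calculus along lines, and the curvature jump *)

Lemma derivable_nearP {R : realType} (g : R -> R) (x : R) : derivable g x 1 ->
  forall e : R, 0 < e -> exists2 k : R, 0 < k &
    forall h, h != 0 -> `|h| < k -> `|'D_1 g x - (g (x + h) - g x) / h| < e.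
Proof.
move=> dg e e0.
have qc : h^-1 * (g (h *: 1 + x) - g x) @[h --> 0^'] --> 'D_1 g x by exact: dg.
have : \forall h \near 0^', `|'D_1 g x - h^-1 * (g (h *: 1 + x) - g x)| < e.
  exact: (cvgr_dist_lt _ _ qc _ e0).
move=> /dnbhs0P[k k0 kq]; exists k => // h h0 hk.
have := kq h h0 hk; rewrite (_ : h *: 1 = h) ?(addrC h x); last exact: mulr1.
by rewrite (mulrC h^-1).
Qed.

(** The derivative [g] vanishes left of 0, hence at 0 by continuity, and its own derivative at 0
    vanishes because the left difference quotients do. So |g u| < e u for small u > 0, and the mean
    value theorem gives f t = (g u) t with 0 < u < t. *)
Lemma flat_left_o2 {R : realType} (f g : R -> R) (a e : R) : 0 < a ->
  (forall t : R, `|t| < a -> is_derive t (1 : R) f (g t)) -> derivable g 0 1 ->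
  (forall t : R, - a < t <= 0 -> f t = 0) -> 0 < e ->
  exists2 k : R, 0 < k & forall t, 0 < t < k -> `|f t| <= e * t ^+ 2.
Proof.
move=> a0 fg dg f0 e0.
have g0 (t : R) : - a < t < 0 -> g t = 0.
  move=> /andP[at_ t0]; have ta : `|t| < a by rewrite ltr_norml at_ (lt_trans t0).
  have [_ <-] := fg t ta; rewrite -[RHS](@derive_cst R R R (0 : R) t (1 : R)).
  apply: near_eq_derive; near=> u; apply: f0.
  have : u \in `]- a, 0[ by near: u; apply: near_in_itvoo; rewrite in_itv /= at_.
  by rewrite in_itv /= => /andP[-> /ltW].
have neg (k : R) : 0 < k -> exists2 h, h < 0 & `|h| < k /\ g h = 0.
  move=> k0; exists (- (Num.min a k / 2)).
    by rewrite oppr_lt0 divr_gt0 // lt_min a0.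
  have m0 : 0 < Num.min a k by rewrite lt_min a0.
  have ma : Num.min a k <= a by rewrite ge_min lexx.
  have mk : Num.min a k <= k by rewrite ge_min lexx orbT.
  split; first by rewrite normrN gtr0_norm; lra.
  by apply: g0; apply/andP; split; lra.
have g00 : g 0 = 0.
  apply: contrapT => /eqP g0N; have g0p : 0 < `|g 0| by rewrite normr_gt0.
  have gc : {for 0, continuous g}.
    by apply: differentiable_continuous; apply/derivable1_diffP.
  have : \forall h \near 0, `|g 0 - g h| < `|g 0|.
    exact: (cvgr_dist_lt _ _ gc _ g0p).
  move=> /nbhs_normP[k /= k0 kg].
  have [h _ [hk gh]] := neg k k0.
  have : `|g 0 - g h| < `|g 0| by apply: kg => /=; rewrite sub0r normrN.
  by rewrite gh subr0 ltxx.
have D0 : 'D_1 g 0 = 0.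
  apply: contrapT => /eqP DN; have Dp : 0 < `|'D_1 g 0| by rewrite normr_gt0.
  have [k k0 kg] := derivable_nearP g 0 dg _ Dp.
  have [h h0 [hk gh]] := neg k k0.
  have := kg h; rewrite lt_eqF // => /(_ isT hk).
  by rewrite add0r gh g00 subr0 mul0r subr0 ltxx.
have [k k0 kg] := derivable_nearP g 0 dg _ e0.
exists (Num.min a k); first by rewrite lt_min a0.
move=> t /andP[t0]; rewrite lt_min => /andP[ta tk].
have fg' u : `|u| < a -> derivable f u 1 by move=> /fg[].
have [||u] := @MVT R f g 0 t t0.
- move=> u; rewrite in_itv /= => /andP[u0 ut]; apply: fg.
  by rewrite gtr0_norm // (lt_trans ut).
- apply: derivable_within_continuous => u; rewrite in_itv /= => /andP[u0 ut].
  by apply: fg'; rewrite ger0_norm // (le_lt_trans ut).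
rewrite in_itv /= => /andP[u0 ut].
rewrite (f0 0) ?lexx ?oppr_lt0 ?a0 // !subr0 => ->.
have := kg u; rewrite gt_eqF // gtr0_norm // (lt_trans ut) // => /(_ isT isT).
rewrite D0 sub0r normrN add0r g00 subr0 normrM normfV (gtr0_norm u0).
rewrite ltr_pdivrMr // => gu; rewrite normrM (gtr0_norm t0).
rewrite expr2 mulrA ler_wpM2r ?(ltW t0) // (le_trans (ltW gu)) //.
by rewrite ler_wpM2l // ltW.
Unshelve. all: by end_near. Qed.

(** Both derivatives are limits of the same difference quotient, so a derivative in the single
    direction [v] suffices. *)
Lemma is_derive_line {R : realType} {V : normedModType R} (F : V -> R^o)
    (p v : V) (t df : R) : is_derive (p + t *: v) v F df ->
  is_derive t (1 : R) (fun u : R => F (p + u *: v)) df.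
Proof.
move=> [dF dFE].
pose f u := F (p + u *: v).
have E : (fun h : R => h^-1 *: ((f \o shift t) (h *: (1 : R)) - f t)) =
    (fun h => h^-1 *: ((F \o shift (p + t *: v)) (h *: v) - F (p + t *: v))).
  apply/funext => h; rewrite /f /= (_ : h *: 1 = h); last exact: mulr1.
  by rewrite scalerDl addrCA.
by split; [rewrite /derivable E|rewrite /derive E].
Qed.

Lemma differentiable_is_derive {R : realType} {V W : normedModType R}
    (F : V -> W) (x v : V) : differentiable F x -> is_derive x v F ('d F x v).
Proof. by move=> dF; split; [exact: diff_derivable|exact: deriveE]. Qed.

(* Along [p + t e] the function [F] vanishes for [t <= 0], hence is [o(t^2)]
   for [t >= 0].  If [F] decreased in the direction [v], then going from the
   arc of radius [r] to this line along [v] would give [F <= - c t^2] there. *)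
Lemma no_curvature_jump {R : realType} {V : normedModType R} (F : V -> R^o)
    (U : set V) (p e v : V) (r l : R) : nbhs p U ->
  (forall x, U x -> differentiable F x) ->
  derivable (fun x => 'd F x e : R^o) p e ->
  {for p, continuous (fun x => 'd F x v : R^o)} ->
  0 < r -> 0 < l ->
  (forall t : R, - l < t <= 0 -> U (p + t *: e) -> F (p + t *: e) = 0) ->
  (forall t : R, 0 < t < r ->
    let q := p + t *: e - (r - Num.sqrt (r ^+ 2 - t ^+ 2)) *: v in
    U q -> F q <= 0) ->
  0 <= 'd F p v.
Proof.
move=> pU dF d2F cF r0 l0 flat arc; rewrite leNgt; apply/negP => dv0.
(* Half of the supposed rate of decrease: the bound [- c] then persists near [p] by continuity. *)
pose c := - 'd F p v / 2.
have c0 : 0 < c by rewrite divr_gt0 // oppr_gt0.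
have : \forall x \near p, U x /\ 'd F x v < - c.
  apply: filterI => //; apply: (cvgr_lt ('d F p v : R) cF).
  by rewrite /c; lra.
move=> /nbhs_normP[k /= k0 kU].
(* For |u| <= |t| the displacement t e + u v has norm at most |t| M, hence less than [k] once |t| <
   k/M. *)
pose M := `|e| + `|v| + 1.
have M0 : 0 < M by rewrite ltr_wpDl // addr_ge0.
pose a := Num.min l (k / M).
have a0 : 0 < a by rewrite lt_min l0 divr_gt0.
have al : a <= l by rewrite ge_min lexx.
have ak : a <= k / M by rewrite ge_min lexx orbT.
clearbody a.
have small (t u : R) : `|t| < a -> `|u| <= `|t| ->
    U (p + t *: e + u *: v) /\ 'd F (p + t *: e + u *: v) v < - c.
  move=> ta ut; apply: kU; rewrite /= -addrA opprD addNKr normrN.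
  apply: le_lt_trans (ler_normD _ _) _; rewrite !normrZ.
  have : `|t| < k / M by exact: lt_le_trans ak.
  rewrite ltr_pdivlMr //; rewrite /M.
  have := normr_ge0 e; have := normr_ge0 v; have := normr_ge0 t.
  by have := normr_ge0 u; nra.
have small0 (t : R) : `|t| < a -> U (p + t *: e).
  by move=> ta; have [] := small t 0 ta; rewrite ?normr0 // scale0r addr0.
pose f (t : R) : R := F (p + t *: e).
pose g (t : R) : R := 'd F (p + t *: e) e.
have fg (t : R) : `|t| < a -> is_derive t (1 : R) f (g t).
  by move=> ta; apply/is_derive_line/differentiable_is_derive/dF; exact: small0.
have dg : derivable g 0 1.
  have := @is_derive_line R V (fun x => 'd F x e : R^o) p e 0.
  by rewrite scale0r addr0 => /(_ _ (derivableP d2F))[].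
have f0 (t : R) : - a < t <= 0 -> f t = 0.
  move=> /andP[at_ t0]; apply: flat.
    by rewrite t0 andbT (le_lt_trans _ at_) // lerN2.
  by apply: small0; rewrite ler0_norm // ltrNl.
(* The constant c/(2r) matches the arc: its drop [s] below the tangent satisfies t^2 <= 2 r s, so |f
   t| <= c s. The mean value theorem along [v] will give f t < - c s. *)
have [|b b0 fb] := @flat_left_o2 R f g a (c / (2 * r)) a0 fg dg f0.
  by rewrite divr_gt0 // mulr_gt0.
pose t := Num.min (Num.min a b) r / 2.
have m0 : 0 < Num.min (Num.min a b) r by rewrite !lt_min a0 b0 r0.
have ma : Num.min (Num.min a b) r <= a by rewrite !ge_min lexx.
have mb : Num.min (Num.min a b) r <= b by rewrite !ge_min lexx orbT.
have mr : Num.min (Num.min a b) r <= r by rewrite ge_min lexx orbT.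
have t0 : 0 < t by rewrite divr_gt0.
have ta : t < a by rewrite /t; lra.
have tb : t < b by rewrite /t; lra.
have tr : t < r by rewrite /t; lra.
pose s := r - Num.sqrt (r ^+ 2 - t ^+ 2).
have sq0 := sqrtr_ge0 (r ^+ 2 - t ^+ 2).
have sq : Num.sqrt (r ^+ 2 - t ^+ 2) ^+ 2 = r ^+ 2 - t ^+ 2.
  by rewrite sqr_sqrtr // subr_ge0 ler_sqr ?nnegrE ltW.
have s0 : 0 < s by rewrite /s; nra.
have st : s <= t by rewrite /s; nra.
have s2 : t ^+ 2 <= 2 * r * s by rewrite /s; nra.
pose q := p + t *: e - s *: v.
(* The bound [s <= t] keeps the whole segment from the arc to the line in the region covered by
   [small]. *)
have qs (u : R) : 0 <= u <= s ->
    U (q + u *: v) /\ 'd F (q + u *: v) v < - c.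
  move=> /andP[u0 us].
  have -> : q + u *: v = p + t *: e + (u - s) *: v.
    by rewrite scalerBl [RHS]addrA addrAC.
  apply: small; first by rewrite gtr0_norm.
  by rewrite (gtr0_norm t0) ler0_norm; lra.
have [||u] := @MVT R (fun u : R => F (q + u *: v))
  (fun u => 'd F (q + u *: v) v) 0 s s0.
  move=> u; rewrite in_itv /= => /andP[u0 us]; apply/is_derive_line.
  by apply/differentiable_is_derive/dF; have [] := qs u; rewrite ?(ltW u0) ?(ltW us).
  apply: derivable_within_continuous => u; rewrite in_itv /= => us.
  have [/dF dq _] := qs u us.
  by have [] := is_derive_line _ _ _ _ _ (differentiable_is_derive _ _ v dq).
rewrite in_itv /= => /andP[u0 us]; rewrite scale0r addr0 subr0 subrK.
have [|_ dq] := qs u; first by rewrite (ltW u0) (ltW us).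
have : F q <= 0.
  apply: arc; first by rewrite t0.
  by have [|+ _] := qs 0; rewrite ?lexx ?(ltW s0) // scale0r addr0.
have := fb t; rewrite t0 tb => /(_ isT); rewrite ler_norml => /andP[ft _].
move: ft; rewrite /f.
have : c / (2 * r) * t ^+ 2 <= c * s.
  by rewrite -mulrA ler_wpM2l ?(ltW c0) // ler_pdivrMl ?mulr_gt0.
nra.
Qed.

(** * Convex domains: superlevel sets of the distance and supporting hyperplanes *)

Section Convex.
Context {R : realType} {n : nat} (Omega : set 'rV[R]_n.+1).
Hypothesis Omega_neq0 : Omega !=set0.
Hypothesis Omega_open : open Omega.
Hypothesis Omega_bounded : bounded_set Omega.
Hypothesis Omega_convex : convex_set Omega.
Implicit Types x y z w : 'rV[R]_n.+1.

Let d := edist (boundary Omega).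

Lemma convex_setE x y (t : R) : Omega x -> Omega y -> 0 <= t <= 1 ->
  Omega (t *: x + (1 - t) *: y).
Proof.
move=> Ox Oy /andP[t0 t1].
by have := Omega_convex x y (Itv01 t0 t1); rewrite !inE => /(_ Ox Oy).
Qed.

(** If a boundary point were the convex combination shifted by [v] with |v| < r, it would be the
    same combination of [x + v] and [y + v]. Both lie in [Omega], and so would the boundary
    point. *)
Lemma dist_concave (r : R) x y (t : R) : Omega x -> Omega y -> 0 <= t <= 1 ->
  r <= d x -> r <= d y -> r <= d (t *: x + (1 - t) *: y).
Proof.
move=> Ox Oy t01 rx ry; apply: edist_ge; first exact: boundary_neq0.
move=> w bw; rewrite leNgt; apply/negP => cw.
apply: (boundaryN _ Omega_open _ bw).
pose v := w - (t *: x + (1 - t) *: y).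
have vr : enorm (- v) < r by rewrite opprB.
have -> : w = t *: (x + v) + (1 - t) *: (y + v).
  by apply/rowP => i; rewrite !mxE; ring.
have xv z : z - (z + v) = - v by rewrite opprD addNKr.
apply: convex_setE => //.
  by apply: (dist_ball _ Omega_open _ _ Ox); rewrite xv (lt_le_trans vr).
by apply: (dist_ball _ Omega_open _ _ Oy); rewrite xv (lt_le_trans vr).
Qed.

(** A point [u] of [Omega] beyond the hyperplane through [y] normal to [y - x] would place [y]
    between [u] and a point of the ball around [x], hence inside [Omega]. Strictness follows by
    pushing [w] slightly outwards within [Omega]. *)
Lemma support x y w : Omega x -> boundary Omega y -> d x = enorm (x - y) ->
  Omega w -> dot (w - y) (y - x) < 0.
Proof.
move=> Ox by_ dxy.
have le0 u : Omega u -> dot (u - y) (y - x) <= 0.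
  move=> Ou; rewrite leNgt; apply/negP => uy.
  apply: (boundaryN _ Omega_open _ by_).
  set m := dot _ _ in uy.
  pose N := dot (u - y) (u - y) + 1.
  have N0 : 0 < N by rewrite ltr_wpDl // dot_ge0.
  (* With t N = m, the squared distance from [x] to y + t (y - u) is |y - x|^2 - t m - t^2, less
     than [d x] squared. The 1 in [N] keeps the denominator positive. *)
  pose t := m / N.
  have t0 : 0 < t by rewrite divr_gt0.
  have tN : t * N = m by rewrite mulfVK ?gt_eqF.
  have Oz : Omega (y + t *: (y - u)).
    apply: (dist_ball _ Omega_open _ _ Ox).
    have E : y + t *: (y - u) - x = (y - x) - t *: (u - y).
      by rewrite -scalerN opprB addrAC.
    rewrite enormB -/d dxy (enormB x y) E enorm_lt ?enorm_ge0 // sqr_enorm.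
    have NE : dot (u - y) (u - y) = N - 1 by rewrite addrK.
    have mE : dot (u - y) (y - x) = m by [].
    clearbody t N m; move: (y - x) (u - y) NE mE => a b NE mE.
    by rewrite !dotE (dotC a b) NE mE; nra.
  have t1 : 0 < 1 + t by rewrite addr_gt0.
  have -> : y = (1 + t)^-1 *: (y + t *: (y - u)) + (1 - (1 + t)^-1) *: u.
    by apply/rowP => i; rewrite !mxE; field; rewrite gt_eqF.
  apply: convex_setE => //.
  by rewrite invr_ge0 ltW //= invf_le1 // lerDl ltW.
move=> Ow; have dw := dist_gt0 _ Omega_neq0 Omega_open Omega_bounded _ Ow.
have dx := dist_gt0 _ Omega_neq0 Omega_open Omega_bounded _ Ox.
(* The push has length half the distance from [w] to the boundary. *)
pose t := edist (boundary Omega) w / (2 * d x).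
have t0 : 0 < t by rewrite divr_gt0 // mulr_gt0.
have := le0 (w + t *: (y - x)).
have -> : w + t *: (y - x) - y = w - y + t *: (y - x) by rewrite addrAC.
have xy : 0 < dot (y - x) (y - x).
  by rewrite -sqr_enorm enormB -dxy exprn_gt0.
rewrite dotDl dotZl; suff O : Omega (w + t *: (y - x)) by move/(_ O); nra.
apply: (dist_ball _ Omega_open _ _ Ow).
rewrite opprD addNKr enormN enormZ gtr0_norm // enormB -dxy.
rewrite (_ : t * d x = edist (boundary Omega) w / 2); last first.
  by rewrite /t; field; rewrite gt_eqF.
lra.
Qed.

Lemma support_closure x y w : Omega x -> boundary Omega y ->
  d x = enorm (x - y) -> closure Omega w -> dot (w - y) (y - x) <= 0.
Proof.
move=> Ox by_ dxy cw; rewrite leNgt; apply/negP => m0.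
have dx := dist_gt0 _ Omega_neq0 Omega_open Omega_bounded _ Ox.
have [u Ou uw] := enorm_closure _ _ _ cw (divr_gt0 m0 dx).
have := support x y u Ox by_ dxy Ou.
rewrite -(subrKA w) dotDl; have := dot_le_enorm (w - u) (y - x).
rewrite -[w - u]opprB enormN (enormB y) -dxy dotNl.
by move: uw; rewrite ltr_pdivlMr // => ? ? ?; lra.
Qed.
End Convex.

(** * Local defining functions obtained from the charts *)

Lemma diff_coord {R : realType} {V : normedModType R} {m : nat}
    (f : V -> 'rV[R]_m) (i : 'I_m) (x v : V) : differentiable f x ->
  differentiable (fun y => f y 0 i : R^o) x /\
  'd (fun y => f y 0 i : R^o) x v = ('d f x v) 0 i.
Proof.
move=> df; pose g (N : 'rV[R]_m) : R^o := N 0 i.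
have lg : linear g by move=> k M N; rewrite /g !mxE.
pose gL := GRing.isLinear.Build _ _ _ _ g lg.
pose G : {linear 'rV[R]_m -> R^o} := HB.pack g gL.
have cG : continuous G by exact: coord_continuous.
have dG := linear_differentiable (f x) cG.
split; first exact: (differentiable_comp df dG).
have := congr1 (fun h => h v) (diff_comp df dG).
by rewrite [in RHS]/comp (congr1 (fun h => h _) (diff_lin (f x) cG)).
Qed.

Lemma diff_le0 {R : realType} {V : normedModType R} (F : V -> R^o) (p v : V) :
  differentiable F p -> F p = 0 ->
  (\forall t \near (0 : R), 0 < t -> F (p + t *: v) <= 0) -> 'd F p v <= 0.
Proof.
move=> dF Fp /nbhs_normP[k /= k0 kF]; rewrite leNgt; apply/negP => dv0.
have [|dg dgE] := @is_derive_line R V F p v 0 ('d F p v).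
  by rewrite scale0r addr0; exact: differentiable_is_derive.
have := derivable_nearP _ _ dg ('d F p v : R) dv0.
rewrite dgE => -[l l0 lF].
pose h := Num.min k l / 2.
have m0 : 0 < Num.min k l by rewrite lt_min k0.
have mk : Num.min k l <= k by rewrite ge_min lexx.
have ml : Num.min k l <= l by rewrite ge_min lexx orbT.
have h0 : 0 < h by rewrite divr_gt0.
have hk : h < k by rewrite /h; lra.
have hl : h < l by rewrite /h; lra.
have := lF h; rewrite gt_eqF // gtr0_norm // => /(_ isT hl).
rewrite add0r scale0r addr0 Fp subr0 ltr_distlC => /andP[+ _].
rewrite subrr ltNge pmulr_lle0 ?invr_gt0 // kF //=.
by rewrite sub0r normrN gtr0_norm.
Qed.

(** [F] is the last coordinate of the inverse chart, so the chart conditions give its signs and its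
    regularity. Its differential at [p] is nonzero by the chain rule for [phi \o psi], the identity
    near [phi p]. *)
Lemma defining_function {R : realType} {n : nat} (Omega : set 'rV[R]_n.+1) p :
  Ck_domain 2 Omega -> boundary Omega p ->
  exists (U : set 'rV[R]_n.+1) (F : 'rV[R]_n.+1 -> R^o),
    [/\ nbhs p U,
        (forall x, U x -> differentiable F x) /\
        (forall v w, derivable (fun x => 'd F x v : R^o) p w /\
                     {for p, continuous (fun x => 'd F x v : R^o)}),
        forall x, U x -> boundary Omega x -> F x = 0,
        forall x, U x -> ~ Omega x -> F x <= 0 &
        exists v, 'd F p v = 1].
Proof.
move=> C2 bp; have [U [psi [phi [[oU Up] [[psiB _ psiS] psiK]]]]] := C2 _ bp.
move=> [[dpsi _] [dphi d2phi]] psi_pos psi_zero.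
pose F x : R^o := phi x 0 ord_max.
have nU x : U x -> nbhs x U by move=> Ux; exact: open_nbhs_nbhs.
have dF x v : U x -> differentiable F x /\ 'd F x v = ('d phi x v) 0 ord_max.
  by move=> Ux; apply: diff_coord; exact: dphi.
have phiB x : U x -> eball 0 1 (phi x) /\ psi (phi x) = x.
  by move=> /psiS[y By <-]; rewrite psiK ?inE.
exists U, F; split.
- exact: nU.
- split=> [x Ux|v w]; first by have [] := dF x 0 Ux.
  have [d2 _] := d2phi v; have dd := d2 _ Up.
  have [d2F _] := diff_coord (fun x => 'd phi x v) ord_max p 0 dd.
  have E : \forall x \near p, ('d phi x v) 0 ord_max = 'd F x v :> R.
    by apply: filterS (nU _ Up) => x Ux; have [_ ->] := dF x v Ux.
  split.
    have := near_eq_is_derive E (differentiable_is_derive _ _ w d2F).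
    by case.
  apply: cvg_trans (near_eq_cvg E) _.
  by rewrite (dF p v Up).2; exact: differentiable_continuous d2F.
- move=> x Ux bx; have : (boundary Omega `&` U) x by [].
  by rewrite -psi_zero => -[y [By /= y0] <-]; rewrite /F psiK ?inE.
- move=> x Ux nx; rewrite leNgt; apply/negP => Fx.
  have [Bx xE] := phiB _ Ux.
  have : (psi @` (eball 0 1 `&` [set y : 'rV[R]_n.+1 | 0 < y 0 ord_max])) x.
    by exists (phi x).
  by rewrite psi_pos => -[].
have [Bp pE] := phiB _ Up.
have dpsip := dpsi _ Bp.
have nB : \forall y \near phi p, enorm y < 1.
  apply: (cvgr_lt (enorm (phi p)) (enorm_continuous (phi p))).
  by move: Bp; rewrite /eball /= subr0.
have E : \forall y \near phi p, y = (phi \o psi) y.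
  by apply: filterS nB => y y1; rewrite /= psiK // inE /eball /= subr0.
have dphip : differentiable phi (psi (phi p)) by rewrite pE; exact: dphi.
pose v : 'rV[R]_n.+1 := delta_mx 0 ord_max.
(* The image of the last basis vector under the differential of [psi]; the differential of [phi]
   sends it back to a vector with last coordinate 1. *)
exists ('d psi (phi p) v); rewrite (dF _ _ Up).2.
have [_ D] := near_eq_is_derive E (is_derive_id (phi p) v).
have dc := differentiable_comp dpsip dphip.
have chain := congr1 (fun h => h v) (diff_comp dpsip dphip).
have dE : 'd phi (psi (phi p)) ('d psi (phi p) v) = v.
  by rewrite -[RHS]D (deriveE v dc).
by rewrite -[X in 'd phi X]pE dE /v mxE !eqxx.
Qed.

(** * The ridge at height [r]: its normals and its reduction to a point *)

Section HighRidge.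
Context {R : realType} {n : nat} (Omega : set 'rV[R]_n.+1).
Hypothesis Omega_neq0 : Omega !=set0.
Hypothesis Omega_open : open Omega.
Hypothesis Omega_bounded : bounded_set Omega.
Hypothesis Omega_convex : convex_set Omega.
Hypothesis Omega_C2 : Ck_domain 2 Omega.
Implicit Types x y z w : 'rV[R]_n.+1.

Let d := edist (boundary Omega).

Variable r : R.
Hypothesis dist_le : forall y, Omega y -> d y <= r.
Let S : set 'rV[R]_n.+1 := [set x | Omega x /\ d x = r].
Hypothesis S_closed : closed S.
Hypothesis S_near : forall q, Omega q -> exists2 z, S z & enorm (z - q) < r.

Lemma ridge_convex x y (t : R) : S x -> S y -> 0 <= t <= 1 ->
  S (t *: x + (1 - t) *: y).
Proof.
move=> [Ox rx] [Oy ry] t01; have O := convex_setE _ Omega_convex _ _ _ Ox Oy t01.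
split=> //; apply/le_anti; rewrite dist_le //=.
by apply: dist_concave; rewrite -/d ?rx ?ry.
Qed.

(** [v] points from the midpoint [x] to its projection [y]. For [z] in [S] the closed [r]-ball
    around [z] lies in the closure of [Omega], so z + r v stays behind the supporting hyperplane at
    [y], that is, [dot (z - x) v <= 0]. *)
Lemma ridge_normal a b : S a -> S b -> exists2 v, enorm v = 1 &
  [/\ dot (b - a) v = 0, forall z, S z -> dot (z - b) v <= 0 &
      forall w, Omega w -> dot (w - b) v < r].
Proof.
move=> Sa Sb; pose x := 2^-1 *: a + (1 - 2^-1) *: b.
have [Ox dx] : S x by apply: ridge_convex => //; apply/andP; split; lra.
have r0 : 0 < r by rewrite -dx dist_gt0.
have [y by_ dy] := dist_attained _ Omega_neq0 Omega_open Omega_bounded x.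
have xyr : enorm (x - y) = r by rewrite -dy.
pose v := r^-1 *: (y - x).
have v1 : enorm v = 1.
  by rewrite enormZ gtr0_norm ?invr_gt0 // enormB xyr mulVf ?gt_eqF.
have vv : dot v v = 1 by rewrite -sqr_enorm v1 expr1n.
have yE : y - x = r *: v by rewrite scalerA mulfV ?gt_eqF // scale1r.
clearbody v.
have Sv z : S z -> dot (z - x) v <= 0.
  move=> [Oz rz].
  have cz : closure Omega (z + r *: v).
    apply: (dist_cball _ Omega_neq0 Omega_open Omega_bounded _ _ Oz).
    by rewrite addrC addKr enormZ v1 mulr1 gtr0_norm // -rz.
  have := support_closure _ Omega_neq0 Omega_open Omega_bounded Omega_convex
    x y _ Ox by_ dy cz.
  have -> : z + r *: v - y = z - x.
    by rewrite -yE; apply/rowP => i; rewrite !mxE; ring.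
  by rewrite yE dotZr pmulr_rle0.
have bx : b - x = 2^-1 *: (b - a).
  by apply/rowP => i; rewrite !mxE; field.
have ax : a - x = - (2^-1 *: (b - a)).
  by apply/rowP => i; rewrite !mxE; field.
clearbody x.
(* The vectors [a - x] and [b - x] are opposite and both have nonpositive product with [v]. Hence
   [b] may replace [x] as base point. *)
have bav : dot (b - a) v = 0.
  have := Sv _ Sa; have := Sv _ Sb.
  rewrite bx ax dotNl dotZl => ? ?; lra.
have bxv : dot (b - x) v = 0 by rewrite bx dotZl bav mulr0.
exists v => //; split => // [z Sz|w Ow].
  by move: (Sv _ Sz) bxv; rewrite !dotDl !dotNl; lra.
have := support _ Omega_neq0 Omega_open Omega_bounded Omega_convex
  x y _ Ox by_ dy Ow.
have -> : w - y = (w - b) + (b - x) - r *: v.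
  by rewrite -yE; apply/rowP => i; rewrite !mxE; ring.
by rewrite yE dotZr pmulr_rlt0 //; move: bxv; rewrite !dotE vv; lra.
Qed.

Lemma ridge_singleton a b : S a -> S b -> a = b.
Proof.
move=> Sa Sb0; apply: contrapT => ab0.
have r0 : 0 < r by case: Sa => Oa <-; exact: dist_gt0.
have Scompact : compact S.
  apply: (subclosed_compact S_closed (compact_closure_bounded _ Omega_bounded)).
  by move=> x [Ox _]; exact: subset_closure.
have [||c] := @EVT_max_rV R n.+1 (fun z => enorm (z - a)) S _ Scompact.
- by exists a.
- apply: continuous_subspaceT => z.
  apply: (@continuous_comp _ _ _ (fun y => y - a)).
    by apply: continuousB; [move=> ?; exact: cvg_id|exact: cst_continuous].
  exact: enorm_continuous.
rewrite inE => Sc cmax.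
have far z : S z -> enorm (z - a) <= enorm (c - a).
  by move=> Sz; apply: cmax; rewrite inE.
pose L := enorm (c - a).
have L0 : 0 < L.
  rewrite lt0r enorm_ge0 andbT; apply/eqP => L0; apply: ab0.
  have /le_anti/esym/enorm_eq0/subr0_eq // : 0 <= enorm (b - a) <= 0.
  by rewrite enorm_ge0 -L0; exact: far.
pose e := L^-1 *: (c - a).
have eE : c - a = L *: e by rewrite scalerA mulfV ?gt_eqF // scale1r.
have e1 : dot e e = 1.
  by rewrite -sqr_enorm enormZ gtr0_norm ?invr_gt0 // mulVf ?gt_eqF // expr1n.
have [v v1 [cav Sv Ov]] := ridge_normal _ _ Sa Sc.
have vv : dot v v = 1 by rewrite -sqr_enorm v1 expr1n.
have ev : dot e v = 0 by rewrite dotZl cav mulr0.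
clearbody e.
(* As [c] is the point of [S] farthest from [a], the set [S] lies behind [c]
   in the direction [e]. *)
have Se z : S z -> dot (z - c) e <= 0.
  move=> Sz; rewrite -(pmulr_rle0 _ L0) -dotZr -eE.
  have -> : z - c = (z - a) - (c - a) by rewrite opprB addrA subrK.
  rewrite dotDl dotNl -sqr_enorm subr_le0 expr2.
  apply: le_trans (dot_le_enorm _ _) _; rewrite ler_wpM2r ?enorm_ge0 //.
  exact: far.
pose p := c + r *: v.
have outside w : 0 <= dot w v -> ~ Omega (p + w).
  move=> wv /Ov; have -> : p + w - c = r *: v + w.
    by apply/rowP => i; rewrite !mxE; ring.
  by rewrite dotDl dotZl vv; lra.
(* The point c + t e is on the segment from [a] to [c], hence in [S], and its closed [r]-ball
   contains p + t e. *)
have flat (t : R) : - L < t <= 0 -> boundary Omega (p + t *: e).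
  move=> /andP[Lt t0]; split.
    have [Oz dz] : S (c + t *: e).
      have -> : c + t *: e = (- t / L) *: a + (1 - (- t / L)) *: c.
        have -> : a = c - L *: e by rewrite -eE opprB addrC subrK.
        by apply/rowP => i; rewrite !mxE; field; rewrite gt_eqF.
      apply: ridge_convex => //.
      by rewrite divr_ge0 ?oppr_ge0 ?(ltW L0) //= ler_pdivrMr // mul1r lerNl ltW.
    apply: (dist_cball _ Omega_neq0 Omega_open Omega_bounded _ _ Oz).
    have -> : p + t *: e - (c + t *: e) = r *: v.
      by apply/rowP => i; rewrite !mxE; ring.
    by rewrite enormZ v1 mulr1 gtr0_norm // -/d dz.
  by move=> /interior_subset; apply: outside; rewrite dotZl ev mulr0.
(* Here q - c = t e + s v has length [r], where s is the square root. For [z] in [S], [z - c] has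
   nonpositive products with [e] and [v], so |z - q| >= r, against [S_near]. *)
have arc (t : R) : 0 < t < r ->
    ~ Omega (p + t *: e - (r - Num.sqrt (r ^+ 2 - t ^+ 2)) *: v).
  move=> /andP[t0 tr]; set q := p + _ - _ => /S_near[z Sz].
  have s0 := sqrtr_ge0 (r ^+ 2 - t ^+ 2).
  have ss : Num.sqrt (r ^+ 2 - t ^+ 2) ^+ 2 = r ^+ 2 - t ^+ 2.
    by rewrite sqr_sqrtr // subr_ge0 ler_sqr ?nnegrE ltW.
  have := Se z Sz; have := Sv z Sz; move: s0 ss.
  have -> : z - q = (z - c) - (t *: e + Num.sqrt (r ^+ 2 - t ^+ 2) *: v).
    by apply/rowP => i; rewrite !mxE; ring.
  move: (Num.sqrt _) (z - c) => s u s0 ss uv ue.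
  rewrite enorm_lt ?(ltW r0) // !dotE !(dotC _ u) (dotC v e) ev e1 vv.
  by have := dot_ge0 u; nra.
have bp : boundary Omega p.
  by have := flat 0; rewrite scale0r addr0 lexx oppr_lt0 L0; apply.
have [U [F [pU [dF d2F] F0 Fle [w Fw]]]] := defining_function _ p Omega_C2 bp.
have Up := nbhs_singleton pU.
have le0 u : 0 <= dot u v -> 'd F p u <= 0.
  move=> uv; apply: diff_le0; [exact: dF|exact: F0|].
  have : \forall t \near (0 : R), U (p + t *: u).
    apply: (@continuous_line R 'rV[R]_n.+1 p u 0).
    by rewrite scale0r addr0.
  apply: filterS => t Ut t0; apply: Fle => //; apply: outside.
  by rewrite dotZl mulr_ge0 // ltW.
have ge0 : 0 <= 'd F p v.
  have [d2 _] := d2F e e; have [_ cF] := d2F v v.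
  apply: (no_curvature_jump F U p e v r L pU dF d2 cF r0 L0).
    by move=> t tL Ut; exact: F0 _ Ut (flat t tL).
  by move=> t tr q Uq; apply: Fle => //; exact: arc.
(* Both signs force ['d F p v = 0]. Removing from [w] its component along [v] then leaves ['d F p w]
   unchanged, so it is at most 0, although it equals 1. *)
have : 'd F p (w - dot w v *: v) <= 0 by apply: le0; rewrite !dotE vv; lra.
have : 'd F p v <= 0 by apply: le0; rewrite vv.
rewrite linearB linearZ /= Fw => v0.
have -> : 'd F p v = 0 by apply/le_anti; rewrite v0.
by rewrite scaler0 subr0 leNgt ltr01.
Qed.
End HighRidge.

(** * From the one-point ridge to the ball *)

Theorem theorem12 (R : realType) (n : nat) (Omega S : set 'rV[R]_n.+1)
  (Omega_neq0 : Omega !=set0)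
  (Omega_open : open Omega)
  (Omega_bounded : bounded_set Omega)
  (Omega_convex : convex_set Omega)
  (Omega_C2 : Ck_domain 2 Omega)
  (highE : high_ridge Omega = S)
  (cutE : cut_locus Omega = S) :
  (exists x : 'rV[R]_n.+1, S = [set x]) /\
  (exists (c : 'rV[R]_n.+1) (r : R), 0 < r /\ Omega = eball c r).
Proof.
pose d := edist (boundary Omega).
have [|c] := @EVT_max_rV R n.+1 d (closure Omega) _
  (compact_closure_bounded _ Omega_bounded)
  (continuous_subspaceT (edist_continuous _
    (boundary_neq0 _ Omega_neq0 Omega_open Omega_bounded))).
  by have [q Oq] := Omega_neq0; exists q; exact: subset_closure.
rewrite inE => cc cmax.
have dmax y : closure Omega y -> d y <= d c by move=> cy; apply: cmax; rewrite inE.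
have Oc : Omega c.
  have [q Oq] := Omega_neq0; apply: dist_gt0_in => //.
  by apply: lt_le_trans (dmax _ (subset_closure Oq)); exact: dist_gt0.
have dle y : Omega y -> d y <= d c by move=> /subset_closure; exact: dmax.
(* The maximum of [d] is positive, so maximisers over the closure lie in [Omega]. *)
have SE : S = [set x | Omega x /\ d x = d c].
  rewrite -highE; apply/seteqP; split=> x.
    move=> [cx xmax]; have dx : d x = d c by apply/le_anti; rewrite dmax //= xmax.
    split=> //; apply: dist_gt0_in => //.
    by rewrite -/d dx; exact: dist_gt0.
  move=> [Ox dx]; split; first exact: subset_closure.
  by move=> y; rewrite -/d dx; exact: dmax.
(* This is where the cut locus enters: it contains the skeleton and equals [S]. *)
have S_near q : Omega q -> exists2 z, S z & enorm (z - q) < d c.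
  move=> Oq.
  have [z sz zq] := skeleton_near _ Omega_neq0 Omega_open Omega_bounded _ _ Oq dle.
  exists z => //; rewrite -cutE; split; last exact: subset_closure.
  by apply: subset_closure; case: sz.
have S_closed : closed S.
  by rewrite -cutE; apply: closedI; exact: closed_closure.
have Sc : S c by rewrite SE.
have S1 x : S x -> x = c.
  move=> Sx; move: S_closed S_near Sx Sc; rewrite SE => S_closed S_near.
  exact: ridge_singleton.
split; first by exists c; apply/seteqP; split=> [x /S1 //|_ ->].
exists c, (d c); split; first exact: dist_gt0.
(* One inclusion is [S_near] with [c] as the only point of [S]; the other is the ball of radius
   [d c] inside [Omega]. *)
apply/seteqP; split=> x; rewrite /eball /=.
  by move=> /S_near[z /S1 ->]; rewrite enormB.
by rewrite enormB; exact: dist_ball.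
Qed.
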